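(* Let $(\mathcal{X},\rho,\nu)$ be a metric measure space with separable metric $\rho$ and finite Borel measure $\nu$. Let $\eta:\mathcal{X}\to\mathcal{Y}$ be measurable and let $\mathbb{X}=(X_n)_{n\ge0}$ be uniformly dominated by $\nu$ at rate $\epsilon(\delta)$. Fix $p>0$. Then, for any nearest neighbor process $(\tilde X_n)_{n\ge1}$, with probability at least $1-p$ the following holds simultaneously for all $N\in\mathbb{N}$: \[\sum_{n=1}^N\mathbb{1}\{\eta(X_n)\neq\eta(\tilde X_n)\}\le\min\left\{N,\ \inf_{V\subset\mathcal{X}}\mathcal{N}_{\mathrm{ML},\eta}(V)+N\cdot\epsilon\big(\nu(V^c)\big)+\sqrt{2N\log\frac{2N}{p}}\right\},\] where the infimum is over measurable $V\subset\mathcal{X}$.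
   Context: $\mathbb{X}_{<n}=\{X_0,\dots,X_{n-1}\}$; a nearest neighbor process is any $(\tilde X_n)_{n\ge1}$ with $\tilde X_n\in\arg\min_{x\in\mathbb{X}_{<n}}\rho(X_n,x)$. $\mathbb{X}$ is uniformly dominated by $\nu$ if for every $\epsilon>0$ there is $\delta>0$ such that every measurable $A$ with $\nu(A)<\delta$ satisfies $\sup_n\Pr(X_n\in A\mid\mathbb{X}_{<n})<\epsilon$ a.s.; it is uniformly dominated at rate $\epsilon(\cdot)$ if in addition, for every $\delta>0$ and measurable $A$ with $\nu(A)<\delta$, $\sup_n\Pr(X_n\in A\mid\mathbb{X}_{<n})<\epsilon(\delta)$ a.s. $\mathrm{margin}_\eta(x)=\inf\{\rho(x,x'):\eta(x')\neq\eta(x)\}$. A set $U\subset\mathcal{X}$ is mutually-labeling for $\eta$ if $\mathrm{diam}(U)<\mathrm{margin}_\eta(x)$ for all $x\in U$, where $\mathrm{diam}(U)=\sup_{z,z'\in U}\rho(z,z')$. The mutually-labeling covering number $\mathcal{N}_{\mathrm{ML},\eta}(V)$ is the minimal number of mutually-labeling sets for $\eta$ needed to cover $V$ (possibly $+\infty$). *)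

(* Defs.v *)
From HB Require Import structures.
From mathcomp Require Import all_boot all_order all_algebra.
From mathcomp Require Import all_classical all_reals all_analysis.
Set Implicit Arguments. Unset Strict Implicit. Unset Printing Implicit Defensive.
Import Order.TTheory GRing.Theory Num.Theory.
Local Open Scope classical_set_scope.
Local Open Scope ring_scope.

Section Defs.
Context {R : realType}.

Definition is_metric {X : Type} (rho : X -> X -> R) : Prop :=
  [/\ (forall x y, 0 <= rho x y),
      (forall x y, rho x y = 0 <-> x = y),
      (forall x y, rho x y = rho y x) &
      (forall x y z, rho x z <= rho x y + rho y z)].

Definition rho_open {X : Type} (rho : X -> X -> R) (U : set X) : Prop :=
  forall x, U x -> exists2 r : R, 0 < r & [set y | rho x y < r] `<=` U.

Definition rho_separable {X : Type} (rho : X -> X -> R) : Prop :=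
  exists D : set X, countable D /\
    forall x (r : R), 0 < r -> exists2 d, D d & rho x d < r.

Definition rho_borel {d} {X : measurableType d} (rho : X -> X -> R) : Prop :=
  (@measurable d X) = <<s [set U | rho_open rho U] >>.

Definition margin {X Y : Type} (rho : X -> X -> R) (eta : X -> Y) (x : X)
  : \bar R :=
  ereal_inf [set (rho x x')%:E | x' in [set x' | eta x' <> eta x]].

Definition diam {X : Type} (rho : X -> X -> R) (U : set X) : \bar R :=
  ereal_sup [set (rho z z')%:E | z in U & z' in U].

Definition mutually_labeling {X Y : Type} (rho : X -> X -> R) (eta : X -> Y)
  (U : set X) : Prop :=
  forall x, U x -> (diam rho U < margin rho eta x)%E.

(* minimal number of mutually-labeling sets covering V; +oo if none *)
Definition N_ML {X Y : Type} (rho : X -> X -> R) (eta : X -> Y) (V : set X)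
  : \bar R :=
  ereal_inf [set (n%:R)%:E | n in [set n : nat | exists F : nat -> set X,
     (forall i, (i < n)%N -> mutually_labeling rho eta (F i)) /\
     V `<=` \bigcup_(i in [set i : nat | (i < n)%N]) F i]].

Definition past_gen {dO d} {Om : measurableType dO} {X : measurableType d}
  (Xs : nat -> Om -> X) (n : nat) : set (set Om) :=
  [set E | exists i B, (i < n)%N /\ measurable B /\ E = Xs i @^-1` B].

Definition cond_prob_version {dO d} {Om : measurableType dO} {X : measurableType d}
  (P : probability Om R) (Xs : nat -> Om -> X) (n : nat) (A : set X)
  (g : Om -> R) : Prop :=
  [/\ (forall B : set R, measurable B -> <<s past_gen Xs n >> (g @^-1` B)),
      P.-integrable setT (EFin \o g) &
      (forall B, <<s past_gen Xs n >> B ->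
         (\int[P]_(w in B) (g w)%:E = P (B `&` (Xs n @^-1` A)))%E)].

Definition sup_cond_prob_lt {dO d} {Om : measurableType dO} {X : measurableType d}
  (P : probability Om R) (Xs : nat -> Om -> X) (A : set X) (c : R) : Prop :=
  exists g : nat -> Om -> R,
    (forall n, cond_prob_version P Xs n A (g n)) /\
    {ae P, forall w, (ereal_sup (range (fun n => (g n w)%:E)) < c%:E)%E}.

Definition uniformly_dominated {dO d} {Om : measurableType dO} {X : measurableType d}
  (P : probability Om R) (Xs : nat -> Om -> X) (nu : set X -> \bar R) : Prop :=
  forall e : R, 0 < e -> exists2 delta : R, 0 < delta &
    forall A, measurable A -> (nu A < delta%:E)%E -> sup_cond_prob_lt P Xs A e.

Definition uniformly_dominated_at_rate {dO d} {Om : measurableType dO}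
  {X : measurableType d} (P : probability Om R) (Xs : nat -> Om -> X)
  (nu : set X -> \bar R) (eps : R -> R) : Prop :=
  uniformly_dominated P Xs nu /\
  forall delta : R, 0 < delta -> forall A, measurable A ->
    (nu A < delta%:E)%E -> sup_cond_prob_lt P Xs A (eps delta).

Definition nearest_neighbor_process {Om X : Type} (rho : X -> X -> R)
  (Xs Xt : nat -> Om -> X) : Prop :=
  forall n w, (0 < n)%N ->
    (exists2 i, (i < n)%N & Xt n w = Xs i w) /\
    (forall i, (i < n)%N -> rho (Xs n w) (Xt n w) <= rho (Xs n w) (Xs i w)).

Definition mistakes {Om X Y : Type} (eta : X -> Y) (Xs Xt : nat -> Om -> X)
  (N : nat) (w : Om) : R :=
  \sum_(1 <= n < N.+1) (asbool (eta (Xs n w) <> eta (Xt n w)))%:R.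

Definition mistake_bound {d} {X : measurableType d} {Y : Type}
  (rho : X -> X -> R) (eta : X -> Y) (nu : set X -> \bar R) (eps : R -> R)
  (p : R) (N : nat) : \bar R :=
  Order.min (N%:R)%:E
   (ereal_inf [set (N_ML rho eta V + (N%:R * eps (fine (nu (~` V))))%:E
                    + (Num.sqrt (2 * N%:R * ln (2 * N%:R / p)))%:E)%E
              | V in [set V : set X | measurable V]]).

End Defs.

(* Main.v *)
(* Each mutually-labeling set, and likewise each single point, is responsible
   for at most one mistake; so if k such sets cover V, the mistakes up to time N
   are at most k plus the number of visits to the complement of V.  Hoeffding's
   argument bounds these visits by N * eps (nu (~` V)) plus a deviation term.

   Two points need care.  The rate only bounds the conditional probability of
   sets of mass strictly less than delta, so eps (nu A) need not control A
   itself, but it controls A minus a suitable point, which costs one more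
   mistake; the slack sqrt (2 N log (2 N / p)) absorbs it.  The infimum over V
   is inside the event, but the number of mistakes is an integer, so for each N
   a single near-optimal V suffices, and the union bound is only over N. *)
Require Import Defs.
From HB Require Import structures.
From mathcomp Require Import all_boot all_order all_algebra.
From mathcomp Require Import ring lra.
From mathcomp Require Import all_classical all_reals all_analysis.
From mathcomp Require Import measurable_realfun.
Import Order.TTheory GRing.Theory Num.Theory.
Import numFieldNormedType.Exports.
Local Open Scope classical_set_scope.
Local Open Scope ring_scope.

(** * Exponential inequalities behind Hoeffding's bound *)

Section Analytic.
Context {R : realType}.
Implicit Types x c l t : R.

(** The difference of the two sides vanishes at 0 and has derivative [y * (expR y - expR (- y))],
    nonnegative for [y >= 0]. *)
Lemma sinh_le_mul_cosh x : 0 <= x ->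
  expR x - expR (- x) <= x * (expR x + expR (- x)).
Proof.
move=> x0.
pose f := fun y : R => y * (expR y + expR (- y)) - (expR y - expR (- y)).
have df y : is_derive y (1:R) f (y * (expR y - expR (- y))).
  by rewrite /f; apply: is_derive_eq; rewrite /GRing.scale /=; ring.
have : f 0 <= f x.
  apply: (@ger0_derive1_ndecry _ f 0) => //.
  - move=> y; rewrite in_itv /= andbT => y0.
    rewrite derive1E derive_val mulr_ge0 ?(ltW y0)// subr_ge0 ler_expR; lra.
  - apply: continuous_subspaceT => y; apply: differentiable_continuous.
    exact/derivable1_diffP.
by rewrite /f oppr0 expR0; lra.
Qed.

(** The quotient of the two sides is nonincreasing on [y >= 0]: by [sinh_le_mul_cosh] its derivative
    is nonpositive. *)
Lemma cosh_le_expR_sqr x : 0 <= x ->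
  (expR x + expR (- x)) / 2 <= expR (x ^+ 2 / 2).
Proof.
move=> x0.
pose f := fun y : R => expR (- (y ^+ 2 / 2)) * (expR y + expR (- y)).
have df y : is_derive y (1:R) f
    (expR (- (y ^+ 2 / 2)) * (expR y - expR (- y) - y * (expR y + expR (- y)))).
  rewrite /f; apply: is_derive_eq; rewrite /GRing.scale /=; by field.
have : f x <= f 0.
  apply: (@ler0_derive1_nincry _ f 0) => //.
  - move=> y; rewrite in_itv /= andbT => y0.
    rewrite derive1E derive_val mulr_ge0_le0 ?expR_ge0// subr_le0.
    exact/sinh_le_mul_cosh/ltW.
  - apply: continuous_subspaceT => y; apply: differentiable_continuous.
    exact/derivable1_diffP.
rewrite /f expr0n /= mul0r oppr0 expR0 mul1r => h.
rewrite expRN mulrC ler_pdivrMr ?expR_gt0// in h.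
by rewrite ler_pdivrMr// mulrC; move: h; rewrite mulrC.
Qed.

Lemma expR_chord c l : 0 <= c <= 1 -> expR (c * l) <= 1 - c + c * expR l.
Proof.
case/andP=> c0 c1.
(* Jensen by tangent lines: with weights [1 - c] and [c] the two exponents average to 0, so the
   weighted exponentials sum to at least 1. *)
have e1 := expR_ge1Dx (- (c * l)); have e2 := expR_ge1Dx (l - c * l).
have -> : 1 - c + c * expR l =
    expR (c * l) * ((1 - c) * expR (- (c * l)) + c * expR (l - c * l)).
  rewrite mulrDr !(mulrCA (expR _)) -!expRD addrN expR0.
  by rewrite (addrC l) addrA addrN add0r; ring.
rewrite ler_peMr ?expR_ge0//; nra.
Qed.

(* Symmetrization: multiplying by an independent copy bounds the left side
   times expR (- (c * l)) by (1 + cosh l) / 2 = cosh (l / 2) ^ 2. *)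
Lemma bernoulli_mgf_le c l : 0 <= c <= 1 -> 0 <= l ->
  1 + c * (expR l - 1) <= expR (c * l + l ^+ 2 / 4).
Proof.
move=> c01 l0; have /andP[c0 c1] := c01.
have h1 := expR_chord c (- l) c01.
have l20 : 0 <= l / 2 by rewrite divr_ge0.
have := cosh_le_expR_sqr _ l20 => h2.
set a := expR (l / 2) in h2; set b := expR (- (l / 2)) in h2.
have a0 : 0 < a by exact: expR_gt0.
have b0 : 0 < b by exact: expR_gt0.
have ab : a * b = 1 by rewrite -expRD addrN expR0.
have la : expR l = a ^+ 2 by rewrite expr2 -expRD; congr expR; field.
have lb : expR (- l) = b ^+ 2 by rewrite expr2 -expRD; congr expR; field.
have -> : expR (c * l + l ^+ 2 / 4) =
    expR (c * l) * expR ((l / 2) ^+ 2 / 2) ^+ 2.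
  by rewrite (expr2 (expR _)) -!expRD; congr expR; field.
have h3 : ((a + b) / 2) ^+ 2 <= expR ((l / 2) ^+ 2 / 2) ^+ 2.
  by rewrite ler_pXn2r// nnegrE ?expR_ge0//; lra.
have : expR (c * l) * ((a + b) / 2) ^+ 2 <=
    expR (c * l) * expR ((l / 2) ^+ 2 / 2) ^+ 2 by rewrite ler_pM2l ?expR_gt0.
apply: le_trans.
rewrite -ler_pdivrMl ?expR_gt0// -expRN.
have h5 : expR (- (c * l)) * (1 + c * (expR l - 1)) <=
    (1 - c + c * expR (- l)) * (1 + c * (expR l - 1)).
  by rewrite ler_wpM2r -?mulrN//; have := expR_ge1Dx l; nra.
apply: (le_trans h5); rewrite la lb.
have -> : (1 - c + c * b ^+ 2) * (1 + c * (a ^+ 2 - 1)) =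
    (1 - c) ^+ 2 + c ^+ 2 * (a * b) ^+ 2 +
    c * (1 - c) * (a ^+ 2 + b ^+ 2) by ring.
rewrite ab expr1n mulr1.
have : (a + b) ^+ 2 = a ^+ 2 + b ^+ 2 + 2 by rewrite sqrrD ab; ring.
have : (a - b) ^+ 2 = a ^+ 2 + b ^+ 2 - 2 by rewrite sqrrB ab; ring.
have := sqr_ge0 (a - b); rewrite exprMn.
(* What remains is [1 + c * (1 - c) * (s - 2) <= (s + 2) / 4], from [s >= 2] and
   [c * (1 - c) <= 1 / 4]. *)
move: (a ^+ 2 + b ^+ 2) => s; have := sqr_ge0 (1 - 2 * c); nra.
Qed.

Lemma expR1_le3 : expR 1 <= 3 :> R.
Proof.
(* Six is the least [n] with [(1 - 1 / n) ^+ n >= 1 / 3]. *)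
have h := expR_ge1Dx (- (1 / 6) : R).
have h6 : expR (- (1 / 6)) ^+ 6 = (expR 1)^-1 :> R.
  by rewrite -expRM_natl -expRN; congr expR; field.
have : (5 / 6) ^+ 6 <= (expR 1)^-1 :> R.
  by rewrite -h6; apply: lerXn2r; rewrite ?nnegrE ?expR_ge0//; lra.
have e0 : 0 < expR 1 :> R by exact: expR_gt0.
by rewrite -[(expR 1)^-1]mul1r ler_pdivlMr//; lra.
Qed.

End Analytic.

(** * Counting visits to a set *)

Section HitCount.
Context {X Om : Type} (Xs : nat -> Om -> X).
Implicit Types (A : set X) (n : nat) (w : Om).

(** Time 0 is left out, as in the mistake count; [n] itself is excluded, so that [hits A n] is
    determined by the past of time [n]. *)
Definition hits A n (w : Om) : nat :=
  \sum_(1 <= i < n) (`[< A (Xs i w) >] : nat).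

Definition hits_eq A n (j : nat) : set Om := [set w | hits A n w = j].

Lemma hitsS A n w : hits A n.+2 w = (hits A n.+1 w + `[< A (Xs n.+1 w) >])%N.
Proof. by rewrite /hits big_nat_recr. Qed.

Lemma hits_eqS0 A n :
  hits_eq A n.+2 0%N = hits_eq A n.+1 0%N `\` Xs n.+1 @^-1` A.
Proof.
apply/seteqP; split=> w; rewrite /hits_eq /= hitsS.
  by case: asboolP => Aw; rewrite ?addn1 ?addn0.
by move=> [-> nA]; rewrite asboolF.
Qed.

Lemma hits_eqSS A n j : hits_eq A n.+2 j.+1 =
  (hits_eq A n.+1 j.+1 `\` Xs n.+1 @^-1` A) `|`
  (hits_eq A n.+1 j `&` Xs n.+1 @^-1` A).
Proof.
apply/seteqP; split=> w; rewrite /hits_eq /= hitsS.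
  by case: asboolP => Aw; rewrite ?addn1 ?addn0; [case; right|left].
by case=> -[-> ?]; [rewrite asboolF// addn0|rewrite asboolT// addn1].
Qed.

Lemma hits_eq1 A j : hits_eq A 1 j = if j == 0%N then setT else set0.
Proof.
by case: j => [|j]; apply/seteqP; split=> w; rewrite /hits_eq /= /hits big_geq.
Qed.

Lemma hits_le A n w : (hits A n.+1 w <= n)%N.
Proof.
elim: n => [|n IH]; first by rewrite /hits big_geq.
by rewrite hitsS; apply: leq_trans (leq_add IH (leq_b1 _)) _; rewrite addn1.
Qed.

End HitCount.

(** * Exponential moments and tails of the visit count *)

Section Hits.
Context {R : realType} {d dO : measure_display} {X : measurableType d}
  {Om : measurableType dO} (P : probability Om R) (Xs : nat -> Om -> X).
Hypothesis mXs : forall n, measurable_fun setT (Xs n).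
Implicit Types (A : set X) (B : set Om) (c : R) (n : nat).

(* P (Xs n \in A | Xs 0, ..., Xs (n - 1)) <= c almost surely, tested against the
   events of the past. *)
Definition dominated c A := forall n B, <<s past_gen Xs n >> B ->
  (P (B `&` Xs n @^-1` A) <= c%:E * P B)%E.

Lemma measurable_preimage_Xs n A : measurable A -> measurable (Xs n @^-1` A).
Proof. by move=> mA; rewrite -[_ @^-1` _]setTI; exact: mXs. Qed.

Lemma past_measurable n B : <<s past_gen Xs n >> B -> measurable B.
Proof.
apply: smallest_sub; first exact: sigma_algebra_measurable.
by move=> _ [i [A [_ [mA ->]]]]; exact: measurable_preimage_Xs.
Qed.

Lemma past_preimage n i A : (i < n)%N -> measurable A ->
  <<s past_gen Xs n >> (Xs i @^-1` A).
Proof. by move=> ltin mA; apply: sub_sigma_algebra; exists i, A. Qed.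

Lemma sub_past m n : (m <= n)%N ->
  <<s past_gen Xs m >> `<=` <<s past_gen Xs n >>.
Proof.
move=> lemn; apply: sub_sigma_algebra2 => _ [i [A [ltim [mA ->]]]].
by exists i, A; split=> //; exact: leq_trans lemn.
Qed.

Lemma sup_cond_prob_lt_dominated c A : 0 <= c ->
  sup_cond_prob_lt P Xs A c -> dominated c A.
Proof.
move=> c0 [g [cg gc]] n B pB.
have mB := past_measurable _ _ pB.
have [_ ig /(_ _ pB) <-] := cg n.
have mg : measurable_fun B (EFin \o g n).
  by apply: measurable_funTS; exact: measurable_int ig.
(* The version [g n] may take negative values, so its positive part is compared with [c]; this is
   where [0 <= c] enters. *)
rewrite integralE (@le_trans _ _ (\int[P]_(x in B) ((EFin \o g n)^\+ x)))%E//.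
  rewrite -[leRHS]adde0 leeD2l// oppe_le0.
  by apply: integral_ge0 => w _; exact: funeneg_ge0.
rewrite -integral_cst//; apply: ae_ge0_le_integral => //.
  exact: measurable_funepos.
apply: (@filterS _ _ (ae_filter_ringOfSetsType P) _ _ _ gc) => w gw _.
rewrite funeposE ge_max /= !lee_fin c0 andbT -lee_fin.
by apply/ltW/(le_lt_trans _ gw)/ereal_sup_ubound; exists n.
Qed.

Lemma dominatedS c A A' : A `<=` A' -> measurable A -> measurable A' ->
  dominated c A' -> dominated c A.
Proof.
move=> sA mA mA' dA n B pB; apply: le_trans (dA n B pB).
have mB := past_measurable _ _ pB.
apply: le_measure; rewrite ?inE.
- by apply: measurableI => //; exact: measurable_preimage_Xs.
- by apply: measurableI => //; exact: measurable_preimage_Xs.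
- by move=> w [Bw Aw]; split => //; exact: sA.
Qed.

Lemma dominatedU c1 c2 A1 A2 : measurable A1 -> measurable A2 ->
  dominated c1 A1 -> dominated c2 A2 -> dominated (c1 + c2) (A1 `|` A2).
Proof.
move=> mA1 mA2 d1 d2 n B pB.
have mB := past_measurable _ _ pB.
rewrite preimage_setU setIUr.
have fP : P B \is a fin_num by exact: fin_num_measure.
rewrite -(fineK fP) -EFinM mulrDl EFinD !EFinM (fineK fP).
apply: le_trans (leeD (d1 n B pB) (d2 n B pB)).
by apply: measureU2; apply: measurableI => //; exact: measurable_preimage_Xs.
Qed.

Lemma dominated_closure c A :
  (forall e, 0 < e -> dominated (c + e) A) -> dominated c A.
Proof.
move=> de n B pB; apply/lee_addgt0Pr => e e0.
have mB := past_measurable _ _ pB.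
apply: le_trans (de e e0 n B pB) _.
have fP : P B \is a fin_num by exact: fin_num_measure.
rewrite -(fineK fP) -!EFinM -EFinD lee_fin mulrDl lerD2l ler_piMr ?(ltW e0)//.
by rewrite -lee_fin fineK// probability_le1.
Qed.

Lemma past_hits_eq A n j : measurable A ->
  <<s past_gen Xs n.+1 >> (hits_eq Xs A n.+1 j).
Proof.
move=> mA; elim: n j => [|n IH] j.
  rewrite hits_eq1; case: ifP => _.
    exact: (@measurableT _ (g_sigma_algebraType (past_gen Xs 1))).
  exact: sigma_algebra0.
have mS := @sub_past n.+1 n.+2 (leqnSn _).
have mP := past_preimage n.+2 n.+1 A (leqnn _) mA.
have mE j' : <<s past_gen Xs n.+2 >> (hits_eq Xs A n.+1 j').
  by exact: (mS _ (IH _)).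
have mD j' : <<s past_gen Xs n.+2 >> (hits_eq Xs A n.+1 j' `\` Xs n.+1 @^-1` A).
  by apply: (@measurableD _ (g_sigma_algebraType (past_gen Xs n.+2)));
    [exact: mE|exact: mP].
case: j => [|j]; first by rewrite hits_eqS0; exact: mD.
rewrite hits_eqSS.
apply: (@measurableU _ (g_sigma_algebraType (past_gen Xs n.+2))).
  exact: mD.
by apply: (@measurableI _ (g_sigma_algebraType (past_gen Xs n.+2)));
  [exact: mE|exact: mP].
Qed.

Lemma measurable_hits_eq A n j :
  measurable A -> measurable (hits_eq Xs A n.+1 j).
Proof. by move=> mA; apply: past_measurable; exact: past_hits_eq. Qed.

(** The moment generating function at [y = expR l], written as a finite sum over level sets. Level
    sets are past events, so domination applies to each, and every time step costs a factor of at
    most [1 + c * (y - 1)]. *)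
Lemma hits_mgf_le A c y n K : measurable A -> dominated c A ->
  0 <= c -> 1 <= y ->
  \sum_(j < K) fine (P (hits_eq Xs A n.+1 j)) * y ^+ j <=
  (1 + c * (y - 1)) ^+ n.
Proof.
move=> mA dA c0 y1; elim: n => [|n IH].
  rewrite expr0; case: K => [|K]; first by rewrite big_ord0.
  rewrite big_ord_recl hits_eq1 eqxx probability_setT mulr1 big1 ?addr0//.
  by move=> i _; rewrite hits_eq1 measure0 mul0r.
pose q j := fine (P (hits_eq Xs A n.+1 j)).
(* [r j] is the mass that moves from level [j] to level [j.+1] at the new time. *)
pose r j := fine (P (hits_eq Xs A n.+1 j `&` Xs n.+1 @^-1` A)).
have mq j := measurable_hits_eq A n j mA.
have mZ := measurable_preimage_Xs n.+1 A mA.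
have mr j : measurable (hits_eq Xs A n.+1 j `&` Xs n.+1 @^-1` A).
  exact: measurableI.
have mD j : measurable (hits_eq Xs A n.+1 j `\` Xs n.+1 @^-1` A).
  exact: measurableD.
have fP B : measurable B -> P B \is a fin_num by exact: fin_num_measure.
have r0 j : 0 <= r j by rewrite /r fine_ge0.
have rq j : r j <= c * q j.
  by rewrite -lee_fin EFinM /r /q !fineK ?fP//; apply: dA; exact: past_hits_eq.
have PD j : fine (P (hits_eq Xs A n.+1 j `\` Xs n.+1 @^-1` A)) = q j - r j.
  by rewrite measureD// ?fineB ?fP// ltey_eq fP.
have q0 : fine (P (hits_eq Xs A n.+2 0%N)) = q 0%N - r 0%N.
  by rewrite hits_eqS0 PD.
have qS j : fine (P (hits_eq Xs A n.+2 j.+1)) = q j.+1 - r j.+1 + r j.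
  rewrite hits_eqSS measureU//; last by apply/seteqP; split=> w // [[_ ?] []].
  by rewrite fineD ?fP// PD.
(* Only an inequality: the mass moving out of the top level is cut off on the left and kept on the
   right. *)
have step : \sum_(j < K) fine (P (hits_eq Xs A n.+2 j)) * y ^+ j <=
    \sum_(j < K) (q j - r j + r j * y) * y ^+ j.
  under [leRHS]eq_bigr do rewrite mulrDl.
  case: K {IH} => [|K]; first by rewrite !big_ord0.
  rewrite big_split /= big_ord_recl /= q0 [X in _ <= X + _]big_ord_recl /=.
  rewrite -addrA lerD2l.
  under eq_bigr do rewrite qS mulrDl.
  rewrite big_split /= lerD2l big_ord_recr /=.
  have -> : \sum_(i < K) r i * y ^+ bump 0 i = \sum_(i < K) r i * y * y ^+ i.
    by apply: eq_bigr => i _; rewrite exprS mulrA.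
  by rewrite lerDl !mulr_ge0 ?exprn_ge0//; lra.
apply: (le_trans step); rewrite exprS.
apply: le_trans (_ : (1 + c * (y - 1)) * (\sum_(j < K) q j * y ^+ j) <= _).
  rewrite mulr_sumr; apply: ler_sum => j _; rewrite mulrA ler_wpM2r//.
    by rewrite exprn_ge0//; lra.
  by have := rq j; have := r0 j; nra.
by rewrite ler_wpM2l//; nra.
Qed.

Lemma measurable_hits_ge A n s : measurable A ->
  measurable [set w | s <= (hits Xs A n.+1 w)%:R :> R].
Proof.
move=> mA; rewrite (_ : [set w | _] =
  \bigcup_(j in [set j : nat | s <= j%:R]) hits_eq Xs A n.+1 j).
  by apply: bigcup_measurable => j _; exact: measurable_hits_eq.
apply/seteqP; split=> [w sw|w [j sj hw]]; first by exists (hits Xs A n.+1 w).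
by rewrite /= hw.
Qed.

(** Chernoff's bound, level by level: if [s <= j] then [1 <= expR (l * (j - s))]. *)
Lemma hits_tail_mgf A c n s l : measurable A -> dominated c A ->
  0 <= c -> 0 <= l ->
  (P [set w | (s <= (hits Xs A n.+1 w)%:R :> R)%R] <=
   (expR (- (l * s)) * (1 + c * (expR l - 1)) ^+ n)%:E)%E.
Proof.
move=> mA dA c0 l0.
pose F j := if s <= j%:R then hits_eq Xs A n.+1 j else set0.
have mF j : measurable (F j).
  by rewrite /F; case: ifP => // _; exact: measurable_hits_eq.
apply: (@le_trans _ _ (\sum_(j < n.+1) P (F j))%E).
  apply: content_subadditive => //; first exact: measurable_hits_ge.
  move=> w /= sw; rewrite -bigcup_mkord; exists (hits Xs A n.+1 w) => /=.
    by rewrite ltnS hits_le.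
  by rewrite /F sw.
have y1 : 1 <= expR l by rewrite -expR0 ler_expR.
have := hits_mgf_le A c (expR l) n n.+1 mA dA c0 y1.
rewrite -(ler_pM2l (expR_gt0 (- (l * s)))) -lee_fin; apply: le_trans.
rewrite mulr_sumr -sumEFin; apply: lee_sum => j _; rewrite /F.
have mq := measurable_hits_eq A n j mA.
rewrite -[X in (X <= _)%E]fineK ?fin_num_measure//; last by case: ifP.
rewrite lee_fin; case: ifP => sj; last first.
  by rewrite measure0 !mulr_ge0 ?expR_ge0 ?exprn_ge0 ?fine_ge0.
rewrite mulrCA ler_peMr ?fine_ge0// -expRM_natl -expRD -{1}expR0 ler_expR.
by rewrite addrC subr_ge0 (mulrC l) ler_wpM2r.
Qed.

Lemma hits_hoeffding A c n t : measurable A -> dominated c A ->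
  0 <= c <= 1 -> 0 <= t -> (0 < n)%N ->
  (P [set w | (n%:R * c + t <= (hits Xs A n.+1 w)%:R :> R)%R] <=
   (expR (- (t ^+ 2 / n%:R)))%:E)%E.
Proof.
move=> mA dA c01 t0 n0; have /andP[c0 c1] := c01.
have n0R : 0 < n%:R :> R by rewrite ltr0n.
(* This [l] minimizes the exponent [n * l ^+ 2 / 4 - l * t], with value [- t ^+ 2 / n]. *)
pose l : R := 2 * t / n%:R.
have l0 : 0 <= l by rewrite !mulr_ge0// invr_ge0 ltW.
have := hits_tail_mgf A c n (n%:R * c + t) l mA dA c0 l0.
move=> /le_trans; apply; rewrite lee_fin.
have := bernoulli_mgf_le c l c01 l0 => h.
have h0 : 0 <= 1 + c * (expR l - 1).
  have : 1 <= expR l by rewrite -expR0 ler_expR.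
  by nra.
apply: le_trans (_ : expR (- (l * (n%:R * c + t))) *
  expR (c * l + l ^+ 2 / 4) ^+ n <= _).
  by rewrite ler_wpM2l ?expR_ge0// lerXn2r ?nnegrE ?expR_ge0.
rewrite -expRM_natl -expRD ler_expR le_eqVlt; apply/orP; left; apply/eqP.
by rewrite /l; field; rewrite gt_eqF.
Qed.

End Hits.

(** * Support points in a separable metric space *)

Definition rho_ball {R : realType} {X : Type} (rho : X -> X -> R) x r :=
  [set y | rho x y < r].

Section Support.
Context {R : realType} {d : measure_display} {X : measurableType d}
  (rho : X -> X -> R).
Hypotheses (met : is_metric rho) (sep : rho_separable rho)
  (bor : rho_borel rho).

Lemma measurable_rho_ball x r : measurable (rho_ball rho x r).
Proof.
case: met => _ _ _ tri; rewrite bor; apply: sub_sigma_algebra => y /= xyr.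
exists (r - rho x y); rewrite ?subr_gt0// => z /= yz.
by apply: le_lt_trans (tri x y z) _; lra.
Qed.

Lemma rho_measurable_set1 (x : X) : measurable [set x].
Proof.
case: met => rho0 rhoE rhoC tri.
rewrite -[[set x]]setCK; apply: measurableC.
rewrite bor; apply: sub_sigma_algebra => y /= /eqP xy.
exists (rho x y); last by move=> z /= yz zx; rewrite zx rhoC ltxx in yz.
rewrite lt_neqAle rho0 andbT eq_sym.
by apply/eqP => /rhoE /esym/eqP; exact/negP.
Qed.

(** Otherwise every point has a ball meeting [A] in a null set, and by separability countably many
    such balls cover [A]. *)
Lemma exists_support_point (nu : {measure set X -> \bar R}) (A : set X) :
  measurable A -> (0 < nu A)%E ->
  exists x, forall r, 0 < r -> (0 < nu (A `&` rho_ball rho x r))%E.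
Proof.
case: met => rho0 rhoE rhoC tri mA A0; apply: contrapT => nsupp.
have null x : exists2 r, 0 < r & nu (A `&` rho_ball rho x r) = 0%E.
  apply: contrapT => nx; apply: nsupp; exists x => r r0.
  rewrite lt_neqAle measure_ge0 andbT eq_sym; apply/eqP => e0.
  by apply: nx; exists r.
have [D [/countable_injP[f finj] dD]] := sep.
pose good a k := D a /\ nu (A `&` rho_ball rho a (k.+1%:R^-1)) = 0%E.
(* Centers are indexed by their code under [f], injective on [D], so each [G n k] is empty or the
   trace on [A] of a single ball. *)
pose G n k := [set y | exists2 a, f a = n /\ good a k &
  A y /\ rho a y < k.+1%:R^-1].
have nG n k : nu.-negligible (G n k).
  have [[a [fa ga]]|na] := pselect (exists a, f a = n /\ good a k); last first.
    rewrite (_ : G n k = set0); first exact: negligible_set0.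
    by apply/seteqP; split=> // y [a ga _]; apply: na; exists a.
  exists (A `&` rho_ball rho a (k.+1%:R^-1)); split.
  - by apply: measurableI => //; exact: measurable_rho_ball.
  - by case: ga.
  - move=> y [b [fb gb]] [Ay yb]; split=> //=.
    by rewrite (finj a b) ?inE ?fa ?fb//; [case: ga|case: gb].
have sub : A `<=` \bigcup_n \bigcup_k G n k.
  move=> y Ay; have [r r0 nr] := null y.
  (* With radius below [r / 2], a ball whose center is that close to [y] stays inside the null ball
     around [y]. *)
  have [k _ /(_ _ (leqnn _)) /= kr] :=
    near_infty_natSinv_lt (PosNum (divr_gt0 r0 (ltr0n R 2))).
  have k0 : 0 < k.+1%:R^-1 :> R by rewrite invr_gt0.
  have [a Da ya] := dD y _ k0.
  exists (f a) => //; exists k => //; exists a; last by rewrite rhoC.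
  split=> //; split=> //; apply/eqP; rewrite -measure_le0 -nr.
  have mr x s : measurable (A `&` rho_ball rho x s).
    by apply: measurableI => //; exact: measurable_rho_ball.
  apply: le_measure; rewrite ?inE//.
  move=> z [Az /= az]; split=> //=; apply: le_lt_trans (tri y a z) _.
  have {}az : rho a z < k.+1%:R^-1 := az.
  have {}kr : k.+1%:R^-1 < r / 2 := kr.
  by move: ya kr az; set i := k.+1%:R^-1 => ya kr az; lra.
have : nu.-negligible A.
  apply: (negligibleS sub).
  by apply: negligible_bigcup => n; exact: negligible_bigcup.
move=> /measure_negligible => /(_ mA) e0; by rewrite e0 ltxx in A0.
Qed.

End Support.

(** * From the rate to domination off one point *)

Section RateDominated.
Context {R : realType} {d dO : measure_display} {X : measurableType d}
  {Om : measurableType dO} (P : probability Om R) (Xs : nat -> Om -> X)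
  (rho : X -> X -> R) (nu : {finite_measure set X -> \bar R}) (eps : R -> R).
Hypotheses (met : is_metric rho) (sep : rho_separable rho)
  (bor : rho_borel rho) (mXs : forall n, measurable_fun setT (Xs n))
  (eps0 : forall delta, 0 <= eps delta)
  (dom : uniformly_dominated_at_rate P Xs nu eps).

(* Around a support point x of A, removing a small ball makes the mass of A
   strictly smaller, while the punctured ball has arbitrarily small mass. *)
Lemma exists_dominated_setD1 (A : set X) (x0 : X) : measurable A ->
  exists x, dominated P Xs (eps (fine (nu A))) (A `\ x).
Proof.
move=> mA; have [ud rd] := dom.
have m1 := rho_measurable_set1 _ met bor.
(* The rate says nothing at [delta = 0]; for null [A], uniform domination gives every [e > 0], and
   any point will do. *)
have [A0|A0] := eqVneq (nu A) 0%E.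
  exists x0; apply: dominated_closure => // e e0.
  have [dl dl0 hdl] := ud e e0.
  have dA : dominated P Xs e A.
    apply: sup_cond_prob_lt_dominated => //; first exact: ltW.
    by apply: hdl => //; rewrite A0 lte_fin.
  apply: (dominatedS _ _ mXs _ _ A) => //; first exact: measurableD.
  move=> n B pB; apply: le_trans (dA n B pB) _.
  by rewrite lee_wpmul2r// lee_fin lerDr.
have {}A0 : (0 < nu A)%E by rewrite lt_neqAle eq_sym A0 measure_ge0.
have [x hx] := exists_support_point _ met sep bor nu A mA A0.
exists x; apply: dominated_closure => // e e0.
have [dl dl0 hdl] := ud e e0.
pose F k := A `&` rho_ball rho x (k.+1%:R^-1) `\ x.
have mb r : measurable (A `&` rho_ball rho x r).
  by apply: measurableI => //; exact: measurable_rho_ball.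
have mF k : measurable (F k) by apply: measurableD.
have capF : \bigcap_k F k = set0.
  case: met => rho0 rhoE rhoC tri.
  apply/seteqP; split=> // y Fy.
  have [_ /= yx] := Fy 0%N I.
  have xy0 : 0 < rho x y.
    rewrite lt_neqAle rho0 andbT eq_sym; apply/eqP => /rhoE xy.
    by apply: yx; rewrite xy.
  have [k _ /(_ _ (leqnn _)) /= kr] := near_infty_natSinv_lt (PosNum xy0).
  have [[_ ky] _] := Fy k I.
  by have := lt_trans kr ky; rewrite ltxx.
(* Continuity from above makes some punctured ball lighter than [dl]. *)
have : (nu \o F) n @[n --> \oo] --> nu (\bigcap_k F k).
  apply: nonincreasing_cvg_mu => //.
  - by rewrite ltey_eq fin_num_measure.
  - by rewrite capF.
  - move=> n m nm; apply/subsetPset => y [[Ay /= xy] yx].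
    split=> //; split=> //=.
    by apply: lt_le_trans xy _; rewrite lef_pV2 ?posrE// ler_nat.
rewrite capF measure0 => cF.
have dl0E : (0 < dl%:E)%E by [].
have [k _ /(_ _ (leqnn _)) Fk] := cF _ (open_ereal_lt' dl0E).
set U := A `&` rho_ball rho x (k.+1%:R^-1).
have mU : measurable U by exact: mb.
have U0 : (0 < nu U)%E by apply: hx; rewrite invr_gt0.
(* Removing [U], of positive mass, gives the strict inequality that the rate requires at
   [delta = nu A]. *)
have d1 : dominated P Xs (eps (fine (nu A))) (A `\` U).
  apply: sup_cond_prob_lt_dominated => //; apply: rd.
  - by rewrite fine_gt0// A0 ltey_eq fin_num_measure.
  - exact: measurableD.
  - rewrite fineK ?fin_num_measure// (measureDI nu mA mU).
    rewrite setIidr; last by move=> y [].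
    by rewrite lteDl ?fin_num_measure//; exact: measurableD.
have d2 : dominated P Xs e (F k).
  apply: sup_cond_prob_lt_dominated => //; first exact: ltW.
  exact: hdl.
apply: (dominatedS _ _ mXs _ _ ((A `\` U) `|` F k)).
- move=> y [Ay yx]; have [Uy|nUy] := pselect (U y); [right|left] => //.
- exact: measurableD.
- by apply: measurableU => //; exact: measurableD.
- by apply: dominatedU => //; exact: measurableD.
Qed.

End RateDominated.

(** * Charging mistakes to cells *)

Section Counting.
Context {R : realType} {X Y Om : Type} (rho : X -> X -> R) (eta : X -> Y)
  (Xs Xt : nat -> Om -> X).
Hypotheses (met : is_metric rho) (nn : nearest_neighbor_process rho Xs Xt).

Definition erring n w : bool := `[< eta (Xs n w) <> eta (Xt n w) >].

Definition single_mistake w (U : set X) := forall m n, (m < n)%N ->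
  U (Xs m w) -> U (Xs n w) -> ~~ erring n w.

(** An earlier point of [U] lies within [diam rho U], hence closer than any point of another label,
    so the nearest neighbor has the right label. *)
Lemma mutually_labeling_single_mistake w U :
  mutually_labeling rho eta U -> single_mistake w U.
Proof.
move=> mlU m n ltmn Um Un; apply/asboolPn => err.
have [_ /(_ m ltmn) near] := nn n w (leq_ltn_trans (leq0n m) ltmn).
have : ((rho (Xs n w) (Xs m w))%:E < (rho (Xs n w) (Xt n w))%:E)%E.
  apply: le_lt_trans (_ : diam rho U < _)%E.
    by apply: ereal_sup_ubound; exists (Xs n w) => //; exists (Xs m w).
  apply: lt_le_trans (mlU _ Un) _; apply: ereal_inf_lbound.
  by exists (Xt n w) => //= /esym.
by rewrite lte_fin ltNge near.
Qed.

(** On a return to [x] the nearest neighbor is at distance 0, hence is [x]. This is separate from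
    the previous lemma because a point of zero margin is not mutually labeling. *)
Lemma set1_single_mistake w x : single_mistake w [set x].
Proof.
case: met => rho0 rhoE _ _ m n ltmn /= Xm Xn; apply/asboolPn => err.
have [_ /(_ m ltmn)] := nn n w (leq_ltn_trans (leq0n m) ltmn).
rewrite Xm Xn (rhoE x x).2// => near; apply: err; congr eta.
by rewrite Xn; apply/rhoE/le_anti; rewrite near rho0.
Qed.

Lemma sum_once_le1 (u : nat -> bool) n :
  (forall i j, (i < j)%N -> u i -> ~~ u j) -> (\sum_(1 <= i < n.+1) u i <= 1)%N.
Proof.
move=> once; elim: n => [|n IH]; first by rewrite big_geq.
rewrite big_nat_recr//=; case: (boolP (u n.+1)) => un; last by rewrite addn0.
rewrite big_nat big1 ?add0n// => i /andP[_ lti].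
by case: (boolP (u i)) => // ui; move: (once i n.+1 lti ui); rewrite un.
Qed.

Lemma mistakesE N w :
  mistakes eta Xs Xt N w = (\sum_(1 <= n < N.+1) erring n w)%:R :> R.
Proof. by rewrite natr_sum. Qed.

Lemma mistakes_leN N w : (\sum_(1 <= n < N.+1) erring n w <= N)%N.
Proof.
rewrite -[leqRHS]muln1 -[X in (_ <= X * 1)%N](subn1 N.+1) -sum_nat_const_nat.
by apply: leq_sum => i _; exact: leq_b1.
Qed.

End Counting.

(** Each mistake is charged to a cell [F i] or to a visit to [B]; after exchanging the sums, each
    cell is charged at most once. *)
Lemma mistakes_le_hits {X Y Om : Type} (eta : X -> Y)
    (Xs Xt : nat -> Om -> X) w k (F : nat -> set X) (B : set X) N :
  (forall i, (i < k)%N -> single_mistake eta Xs Xt w (F i)) ->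
  (forall y, (exists2 i, (i < k)%N & F i y) \/ B y) ->
  (\sum_(1 <= n < N.+1) erring eta Xs Xt n w <= k + hits Xs B N.+1 w)%N.
Proof.
move=> sF cov.
apply: (@leq_trans (\sum_(1 <= n < N.+1) (\sum_(i < k)
    (erring eta Xs Xt n w && `[< F i (Xs n w) >] : nat) +
    `[< B (Xs n w) >])))%N.
  apply: leq_sum => n _; case: (erring _ _ _ _ _) => //=.
  have [[i ltik Fi]|By] := cov (Xs n w); last by rewrite asboolT// addn1.
  by rewrite (bigD1 (Ordinal ltik))//= asboolT.
rewrite big_split leq_add2r exchange_big /=.
apply: (@leq_trans (\sum_(i < k) 1)%N); last by rewrite sum1_card card_ord.
apply: leq_sum => i _; apply: sum_once_le1 => m n ltmn /andP[_ /asboolP Fm].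
rewrite negb_and -implybE; apply/implyP => err; apply/asboolPn => Fn.
by have := sF i (ltn_ord i) m n ltmn Fm Fn; rewrite err.
Qed.

Lemma N_ML_attained {R : realType} {X Y : Type} (rho : X -> X -> R)
    (eta : X -> Y) (V : set X) : (N_ML rho eta V < +oo)%E ->
  exists k (F : nat -> set X), [/\ N_ML rho eta V = k%:R%:E,
    (forall i, (i < k)%N -> mutually_labeling rho eta (F i)) &
    V `<=` \bigcup_(i in [set i : nat | (i < k)%N]) F i].
Proof.
rewrite /N_ML; set S := [set n : nat | _] => /ereal_inf_lt[_ [n0 Sn0 <-] _].
have exS : exists n, `[< S n >] by exists n0; exact/asboolP.
case: (ex_minnP exS) => k /asboolP Sk mink; have [F [mlF covF]] := Sk.
exists k, F; split=> //; apply/eqP; rewrite eq_le; apply/andP; split.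
  by apply: ereal_inf_lbound; exists k.
apply: le_ereal_inf_tmp => _ [n Sn <-]; rewrite lee_fin ler_nat.
exact/mink/asboolP.
Qed.

(** * Estimates for the deviation term *)

Section Numerics.
Context {R : realType} (p : R).
Hypotheses (p0 : 0 < p) (p1 : p < 1).
Implicit Type N : nat.

Definition slack N : R := Num.sqrt (2 * N%:R * ln (2 * N%:R / p)).

Lemma ln_ratio_ge N (x : R) : (0 < N)%N -> expR x <= 2 * N%:R ->
  x <= ln (2 * N%:R / p).
Proof.
move=> N0 xN; have NR : 0 < 2 * N%:R :> R by rewrite mulr_gt0// ltr0n.
rewrite -ler_expR lnK ?posrE ?divr_gt0//; apply: (le_trans xN).
by rewrite ler_pdivlMr// ler_piMr// ltW.
Qed.

(** Disposes of small [N] without any exceptional event. It reduces to [expR (N / 2) <= 2 * N],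
    checked at 1, 2 and 3. *)
Lemma le_slack N : (0 < N < 4)%N -> N%:R <= slack N.
Proof.
case/andP=> N0 N4.
have h0 : 0 < expR (2^-1) :> R by exact: expR_gt0.
have h2 : expR (2^-1) ^+ 2 <= 3 :> R.
  by rewrite -expRM_natl divff// expR1_le3.
have : N%:R / 2 <= ln (2 * N%:R / p).
  apply: ln_ratio_ge => //; rewrite expRM_natl.
  by case: N N0 N4 => [|[|[|[|N]]]] // _ _; rewrite ?expr1 ?(exprS _ 2); nra.
move=> h; rewrite -[leLHS]ger0_norm// -sqrtr_sqr ler_wsqrtr//.
have : 0 <= N%:R :> R by [].
nra.
Qed.

Lemma ln_ratio_ge1 N : (3 < N)%N -> 1 <= ln (2 * N%:R / p).
Proof.
move=> N4; apply: ln_ratio_ge; first exact: leq_trans N4.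
have : 4 <= N%:R :> R by rewrite (ler_nat _ 4).
by have := @expR1_le3 R; lra.
Qed.

Lemma slack_ge1 N : (3 < N)%N -> 1 <= slack N.
Proof.
move=> N4; rewrite -[leLHS]sqrtr1 ler_wsqrtr//.
have : 4 <= N%:R :> R by rewrite (ler_nat _ 4).
by have := ln_ratio_ge1 _ N4; nra.
Qed.

(* Since [slack N < N], subtracting 1 from the slack costs at most a factor
   [expR 2] in the tail; the right side telescopes over [3 < N] to [p]. *)
Lemma tail_le N : (3 < N)%N -> slack N < N%:R ->
  expR (- ((slack N - 1) ^+ 2 / N%:R)) <=
  3 * p * ((N.-1)%:R^-1 - N%:R^-1).
Proof.
move=> N4 sN.
have NR : 4 <= N%:R :> R by rewrite (ler_nat _ 4).
have L1 := ln_ratio_ge1 _ N4.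
set a := 2 * N%:R / p in L1.
have a0 : 0 < a by rewrite divr_gt0// mulr_gt0//; lra.
have s2 : slack N ^+ 2 = 2 * N%:R * ln a by rewrite sqr_sqrtr// -/a; nra.
(* The square is at least [slack N ^+ 2 - 2 * slack N], and [slack N < N]. *)
have h : 2 * ln a - 2 <= (slack N - 1) ^+ 2 / N%:R.
  rewrite ler_pdivlMr; last lra.
  by have := sqr_ge0 (slack N); nra.
apply: le_trans (_ : expR (2 * 1 - 2 * ln a) <= _).
  by rewrite ler_expR; lra.
rewrite expRD -mulrN !expRM_natl expRN lnK ?posrE//.
have e0 : 0 < expR 1 :> R by exact: expR_gt0.
have e9 : expR 1 ^+ 2 <= 9 :> R by have := @expR1_le3 R; nra.
have ia : a^-1 = p / (2 * N%:R) by rewrite /a invf_div.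
have pred_N : (N.-1)%:R = N%:R - 1 :> R.
  by rewrite -subn1 natrB//; exact: leq_trans N4.
have -> : 3 * p * ((N.-1)%:R^-1 - N%:R^-1) = 3 * p / (N%:R * (N%:R - 1)).
  by rewrite pred_N; field; lra.
rewrite ia; apply: le_trans (_ : 9 * (p / (2 * N%:R)) ^+ 2 <= _).
  by rewrite ler_wpM2r// exprn_ge0// divr_ge0// ltW.
rewrite ler_pdivlMr; last nra.
(* The last factor is at most 1 because [p < 1]. *)
have -> : 9 * (p / (2 * N%:R)) ^+ 2 * (N%:R * (N%:R - 1)) =
    3 * p * (3 / 4 * p * (1 - N%:R^-1)) by field; lra.
rewrite ler_piMr//; first by rewrite mulr_ge0// ltW.
have : 0 < N%:R^-1 :> R by rewrite invr_gt0; lra.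
have := ltW p0; have := ltW p1; nra.
Qed.

End Numerics.

(** * High-probability bounds at a fixed time *)

Section Mistakes.
Context {R : realType} {d dO : measure_display} {X : measurableType d}
  {Y : Type} {Om : measurableType dO} (P : probability Om R)
  (rho : X -> X -> R) (eta : X -> Y) (Xs Xt : nat -> Om -> X)
  (nu : {finite_measure set X -> \bar R}) (eps : R -> R) (p : R).
Hypotheses (met : is_metric rho) (sep : rho_separable rho)
  (bor : rho_borel rho) (mXs : forall n, measurable_fun setT (Xs n))
  (eps0 : forall delta, 0 <= eps delta)
  (dom : uniformly_dominated_at_rate P Xs nu eps)
  (nn : nearest_neighbor_process rho Xs Xt) (p0 : 0 < p) (p1 : p < 1).

Let nmistakes N w : nat := (\sum_(1 <= n < N.+1) erring eta Xs Xt n w)%N.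

Definition cover_bound N (V : set X) : \bar R :=
  (N_ML rho eta V + (N%:R * eps (fine (nu (~` V))))%:E + (slack p N)%:E)%E.

Lemma N_ML_ge0 V : (0 <= N_ML rho eta V :> \bar R)%E.
Proof. by apply: le_ereal_inf_tmp => _ [n _ <-]; rewrite lee_fin. Qed.

Lemma mistake_boundE N : mistake_bound rho eta nu eps p N =
  Order.min (N%:R)%:E (ereal_inf (cover_bound N @` [set V | measurable V])).
Proof. by []. Qed.

Lemma le_cover_bound N V (x : R) :
  x <= N%:R * eps (fine (nu (~` V))) + slack p N ->
  (x%:E <= cover_bound N V)%E.
Proof.
move=> xb; rewrite /cover_bound -addeA -EFinD.
by rewrite -[leLHS]add0e leeD ?N_ML_ge0// lee_fin.
Qed.

Lemma mistakes_le_of_le_slack N w : N%:R <= slack p N ->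
  ((mistakes eta Xs Xt N w)%:E <= mistake_bound rho eta nu eps p N)%E.
Proof.
move=> Ns; rewrite mistakesE mistake_boundE.
have MN : (nmistakes N w)%:R <= N%:R :> R by rewrite ler_nat mistakes_leN.
rewrite le_min lee_fin MN /=; apply: le_ereal_inf_tmp => _ [V _ <-].
apply: le_cover_bound; have := eps0 (fine (nu (~` V))).
have : 0 <= N%:R :> R by [].
by rewrite /nmistakes in MN; nra.
Qed.

Lemma cover_bound_whp N V : (3 < N)%N -> slack p N < N%:R -> measurable V ->
  exists G : set Om, [/\ measurable G,
    (P G <= (3 * p * ((N.-1)%:R^-1 - N%:R^-1))%:E)%E &
    forall w, ~ G w -> ((nmistakes N w)%:R%:E <= cover_bound N V)%E].
Proof.
move=> N4 sN mV; set c := eps (fine (nu (~` V))).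
have tail := tail_le _ p0 p1 _ N4 sN.
have N0 : (0 < N)%N by exact: leq_trans N4.
have MN w : (nmistakes N w)%:R <= N%:R :> R by rewrite ler_nat mistakes_leN.
have u0 := le_trans (expR_ge0 _) tail.
have s1 := slack_ge1 _ p0 p1 _ N4.
(* Hoeffding needs [c <= 1]; for larger [c] the bound already exceeds [N]. *)
have [c1|c1] := leP 1 c.
  exists set0; split=> //; first by rewrite measure0 lee_fin.
  move=> w _; apply: le_cover_bound; rewrite -/c; have := MN w.
  have : 0 <= N%:R :> R by [].
  nra.
have [Noo|Noo] := eqVneq (N_ML rho eta V) +oo%E.
  exists set0; split=> //; first by rewrite measure0 lee_fin.
  by move=> w _; rewrite /cover_bound Noo -addeA -EFinD addye// leey.
have [k [F [NMLk mlF covF]]] : exists k (F : nat -> set X),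
    [/\ N_ML rho eta V = k%:R%:E,
    (forall i, (i < k)%N -> mutually_labeling rho eta (F i)) &
    V `<=` \bigcup_(i in [set i : nat | (i < k)%N]) F i].
  by apply: N_ML_attained; rewrite lt_neqAle Noo leey.
have mVc : measurable (~` V) by exact: measurableC.
have [x dx] := exists_dominated_setD1 P Xs _ nu eps met sep bor mXs eps0 dom
  (~` V) point mVc.
have mB : measurable (~` V `\ x).
  by apply: measurableD => //; exact: rho_measurable_set1 met bor x.
have c01 : 0 <= c <= 1 by rewrite eps0 ltW.
have t0 : 0 <= slack p N - 1 by rewrite subr_ge0.
exists [set w | N%:R * c + (slack p N - 1) <= (hits Xs (~` V `\ x) N.+1 w)%:R].
split; first exact: measurable_hits_ge.
  apply: le_trans (hits_hoeffding _ _ mXs _ _ N _ mB dx c01 t0 N0) _.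
  by rewrite lee_fin.
move=> w /negP; rewrite -ltNge => hw.
(* The removed point becomes cell number [k]; its possible mistake is the 1 taken from the slack. *)
pose F' i := if (i < k)%N then F i else [set x].
have : (nmistakes N w <= k.+1 + hits Xs (~` V `\ x) N.+1 w)%N.
  apply: (@mistakes_le_hits _ _ _ _ _ _ _ _ F').
    move=> i _; rewrite /F'; case: ifP => ltik.
      by apply: mutually_labeling_single_mistake nn _ _ _; exact: mlF.
    exact: set1_single_mistake met nn _ _.
  move=> y; have [Vy|nVy] := pselect (V y).
    left; have [i /= ltik Fi] := covF y Vy.
    by exists i; [exact: leqW|rewrite /F' ltik].
  have [->|yx] := pselect (y = x); last by right.
  by left; exists k => //; rewrite /F' ltnn.
rewrite -(ler_nat R) natrD -natr1 => Mk.
rewrite /cover_bound NMLk -!EFinD lee_fin -/c; lra.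
Qed.

Lemma mistake_bound_whp N : (3 < N)%N ->
  exists G : set Om, [/\ measurable G,
    (P G <= (3 * p * ((N.-1)%:R^-1 - N%:R^-1))%:E)%E &
    forall w, ~ G w ->
      ((mistakes eta Xs Xt N w)%:E <= mistake_bound rho eta nu eps p N)%E].
Proof.
move=> N4.
have MN w : (nmistakes N w)%:R <= N%:R :> R by rewrite ler_nat mistakes_leN.
have triv : (forall w, ((mistakes eta Xs Xt N w)%:E <=
      mistake_bound rho eta nu eps p N)%E) ->
    exists G : set Om, [/\ measurable G,
    (P G <= (3 * p * ((N.-1)%:R^-1 - N%:R^-1))%:E)%E & forall w, ~ G w ->
      ((mistakes eta Xs Xt N w)%:E <= mistake_bound rho eta nu eps p N)%E].
  move=> all; exists set0; split=> //; rewrite measure0 lee_fin.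
  rewrite mulr_ge0 ?mulr_ge0 ?(ltW p0)// subr_ge0 lef_pV2 ?posrE ?ltr0n.
  - by rewrite ler_nat leq_pred.
  - exact: leq_trans N4.
  - by rewrite -ltnS prednK; apply: leq_trans N4.
have [Ns|sN] := leP N%:R (slack p N).
  by apply: triv => w; exact: mistakes_le_of_le_slack.
set I := ereal_inf (cover_bound N @` [set V | measurable V]).
have [NI|IN] := leP (N%:R%:E) I.
  apply: triv => w; rewrite mistakesE mistake_boundE -/I le_min lee_fin MN /=.
  by apply: le_trans NI; rewrite lee_fin MN.
(* m is the least integer above the infimum: any V with bound below m works. *)
have exm : exists m : nat, (I < m%:R%:E)%E by exists N.
case: (ex_minnP exm) => m Im minm.
have [_ [V mV <-] Vm] := ereal_inf_lt Im.
have [G [mG PG hG]] := cover_bound_whp N V N4 sN mV.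
exists G; split=> // w nGw; have := le_lt_trans (hG w nGw) Vm.
rewrite lte_fin ltr_nat => Mm.
rewrite mistakesE mistake_boundE -/I le_min lee_fin MN /= leNgt.
(* Were the infimum below the mistake count, minimality would put [m] at or below that count. *)
by apply/negP => /minm; rewrite leqNgt Mm.
Qed.

End Mistakes.

(** * Union bound over the times *)

Theorem theorem8 (R : realType)
  (d : measure_display) (X : measurableType d) (rho : X -> X -> R)
  (nu : {finite_measure set X -> \bar R})
  (dY : measure_display) (Y : measurableType dY) (eta : X -> Y)
  (dO : measure_display) (Om : measurableType dO) (P : probability Om R)
  (Xs : nat -> Om -> X) (eps : R -> R) (p : R) (Xt : nat -> Om -> X) :
  is_metric rho -> rho_separable rho -> rho_borel rho ->
  measurable_fun setT eta ->
  (forall n, measurable_fun setT (Xs n)) ->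
  (forall delta, 0 <= eps delta) ->
  uniformly_dominated_at_rate P Xs nu eps ->
  0 < p ->
  nearest_neighbor_process rho Xs Xt ->
  exists E : set Om, [/\ measurable E, ((1 - p)%:E <= P E)%E &
    forall w, E w -> forall N : nat, (0 < N)%N ->
      ((mistakes eta Xs Xt N w)%:E <= mistake_bound rho eta nu eps p N)%E].
Proof.
move=> met sep bor _ mXs eps0 dom p0 nn.
have [p1|p1] := leP 1 p.
  by exists set0; split=> //; rewrite measure0 lee_fin subr_le0.
(* Exceptional events are needed only from time 4 on; [j] stands for [N - 4]. *)
have /choice[G hG] : forall j, exists G : set Om, [/\ measurable G,
    (P G <= (3 * p * (j.+3%:R^-1 - j.+4%:R^-1))%:E)%E &
    forall w, ~ G w -> ((mistakes eta Xs Xt j.+4 w)%:E <=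
      mistake_bound rho eta nu eps p j.+4)%E].
  by move=> j; exact: (mistake_bound_whp P rho eta Xs Xt nu eps p met sep bor
    mXs eps0 dom nn p0 p1 j.+4 isT).
have mG j : measurable (G j) by have [] := hG j.
have mUG : measurable (\bigcup_j G j) by exact: bigcupT_measurable.
have PUG : (P (\bigcup_j G j) <= p%:E)%E.
  apply: le_trans (measure_sigma_subadditive P mG mUG (@subset_refl _ _)) _.
  apply: lime_le; first by apply: is_cvg_nneseries.
  apply: nearW => n.
  (* Telescoped partial sum: the first term is [3 * p / 3], which explains the factor 3 in the tail
     bound. *)
  apply: (@le_trans _ _ (p - 3 * p / n.+3%:R)%:E); last first.
    by rewrite lee_fin gerBl divr_ge0// mulr_ge0// ltW.
  elim: n => [|n IH].
    by rewrite big_geq// lee_fin -mulrA mulrCA divff// mulr1 subrr.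
  rewrite big_nat_recr//=; have [_ hn _] := hG n.
  apply: le_trans (leeD IH hn) _.
  by rewrite -EFinD lee_fin mulrBr addrA subrK.
exists (~` \bigcup_j G j); split; first exact: measurableC.
  by rewrite probability_setC// EFinB leeB.
move=> w nG N N0; have [N4|N4] := ltnP N 4.
  by apply: mistakes_le_of_le_slack => //; apply: le_slack => //; rewrite N0.
have [_ _] := hG (N - 4)%N; rewrite -(addn4 (N - 4)) subnK//; apply.
by move=> Gw; apply: nG; exists (N - 4)%N.
Qed.
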